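(* For every integer $r\geq 4$, the number $2\cdot\frac{r!}{r^r}$ is a non-jump for $r$-graphs (i.e. it is not a jump for $r$-graphs).
   Context: For a set $S$, $S^{(r)}$ denotes the set of all $r$-element subsets of $S$. An $r$-graph ($r$-uniform hypergraph) is a pair $G=(V(G),E(G))$ with $V(G)$ finite and $E(G)\subseteq V(G)^{(r)}$. Its order is $|V(G)|$, and its density is $D(G)=|E(G)|/|V(G)^{(r)}|$. A number $\alpha\in[0,1)$ is a jump for $r$-graphs if there is $\delta=\delta(\alpha)>0$ such that for each $\varepsilon>0$ and each integer $n\geq r$, any sufficiently large $r$-graph (i.e. of order at least some $N=N(\varepsilon,n)$) of density at least $\alpha+\varepsilon$ has a subgraph of order $n$ and density at least $\alpha+\delta$. Otherwise $\alpha\in[0,1)$ is a non-jump for $r$-graphs. *)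

(* Defs.v *)
From mathcomp Require Import all_boot all_order all_algebra.
From mathcomp Require Import reals.

Set Implicit Arguments.
Unset Strict Implicit.
Unset Printing Implicit Defensive.

Import Order.TTheory GRing.Theory Num.Theory.

Local Open Scope ring_scope.

Definition rsubsets (T : finType) (r : nat) (S : {set T}) : {set {set T}} :=
  [set A : {set T} | A \subset S & #|A| == r].

(* The vertex set is a subset of an ambient finite type [T], so that a graph
   and its subgraphs live in the same type. *)
Record rgraph (r : nat) (T : finType) := RGraph {
  verts : {set T};
  edges : {set {set T}};
  edges_sub : edges \subset rsubsets r verts
}.

Definition rgraph_order (r : nat) (T : finType) (G : rgraph r T) : nat :=
  #|verts G|.

(* When [rgraph_order G < r] this is 0 / 0, which is 0 here. *)
Definition density (R : realType) (r : nat) (T : finType) (G : rgraph r T) : R :=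
  #|edges G|%:R / #|rsubsets r (verts G)|%:R.

(* Subgraphs need not be induced. *)
Definition subgraph (r : nat) (T : finType) (H G : rgraph r T) : bool :=
  (verts H \subset verts G) && (edges H \subset edges G).

Definition jump (R : realType) (r : nat) (alpha : R) : Prop :=
  0 <= alpha < 1 /\
  exists2 delta : R, 0 < delta &
    forall (eps : R) (n : nat), 0 < eps -> (r <= n)%N ->
    exists N : nat, forall (T : finType) (G : rgraph r T),
      (N <= rgraph_order G)%N -> alpha + eps <= density R G ->
      exists H : rgraph r T,
        [/\ subgraph H G, rgraph_order H = n & alpha + delta <= density R H].

Definition non_jump (R : realType) (r : nat) (alpha : R) : Prop :=
  0 <= alpha < 1 /\ ~ jump r alpha.

(* Main.v *)
Require Import Defs.
From mathcomp Require Import all_boot all_order all_fingroup all_algebra.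
From mathcomp Require Import reals ring lra zify.

Set Implicit Arguments.
Unset Strict Implicit.
Unset Printing Implicit Defensive.

Import Order.TTheory GRing.Theory Num.Theory.

Local Open Scope ring_scope.

(** Start from the pattern with parts [V1], ..., [V(r-1)] whose edges have two
    vertices in [V1] and one in each other part; its blow-ups have density at
    most [alpha = 2 r!/r^r], and if [V1] is cut into [t] cells, with no edge
    having two vertices in the same cell, a proportion [1/t] is lost.  Split
    [V2] and [V3] into three classes each.  Put on the [t] cells of [V1] a
    12-regular graph of large girth, properly edge-coloured, with two colours
    for every pair of classes of [V2] and of [V3]; for a graph edge [gh] with
    such a colour add all edges with one vertex in each of the cells [g], [h],
    one in each of the two classes, and one in each of [V4], ..., [V(r-1)].
    This gains a proportion [4/(3t)], so the density is [alpha (1 + 1/(3t))].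

    On [n] vertices, [n] less than the girth, the graph becomes a forest.  Let
    [x] be the total weight of [V1], [s] the sum of the squared cell weights
    and [u], [v] the weights of [V2], [V3].  The loss is [s u v]; a forest has
    a small spectral radius, so the gain is at most [s (u^2 + v^2 - u v)], and
    if [4 s <= x^2] then [x^2 u v + s (u - v)^2 <= x^2 (u + v)^2 / 4].  For
    larger [s] the trivial bound [(x^2 - s) max(u, v)^2 / 4] on the gain
    suffices.  By the AM-GM inequality [n] vertices then span at most
    [2 (n/r)^r] edges, which is density [alpha + o(1)] as [n] grows. *)

(** * Cayley graphs of large girth *)

Definition reduced (J : eqType) (s : seq J) : bool := sorted (fun i j => i != j) s.

Definition word_prod (gT : finGroupType) (J : Type) (gen : J -> gT) (s : seq J) : gT :=
  (\prod_(j <- s) gen j)%g.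

(* The Cayley graph of [gT] on the involutions [gen j], edge-coloured by [j], has
   no cycle of length at most [n]. *)
Definition large_girth (gT : finGroupType) (J : eqType) (gen : J -> gT) (n : nat) : Prop :=
  (forall j, (gen j * gen j = 1)%g) /\
  (forall s, reduced s -> (0 < size s <= n)%N -> word_prod gen s <> 1%g).

(* The generators of the large-girth group act on reduced words of length at most
   [n]: the ball of radius [n] in the regular tree, edge-coloured by [J]. *)
Definition push_letter (J : eqType) (n : nat) (j : J) (s : seq J) : seq J :=
  if ~~ reduced s then s else
  if ohead s == Some j then behead s else
  if (size s < n)%N then j :: s else s.

Lemma reduced_cons (J : eqType) (j : J) (s : seq J) :
  reduced (j :: s) = (ohead s != Some j) && reduced s.
Proof.
case: s => [|i s] //=; rewrite /reduced /= eq_sym.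
by congr (~~ _ && _); apply/eqP/eqP => [->|[->]].
Qed.

Lemma size_push_letter (J : eqType) n (j : J) s :
  (size s <= n)%N -> (size (push_letter n j s) <= n)%N.
Proof.
move=> sn; rewrite /push_letter; case: ifP => // _.
case: ifP => _; last by case: ifP.
by rewrite size_behead; apply: leq_trans sn; apply: leq_pred.
Qed.

(** Writing and cancelling [j] undo each other, and the words to which neither applies are fixed. *)
Lemma push_letterK (J : eqType) n (j : J) s :
  (size s <= n)%N -> push_letter n j (push_letter n j s) = s.
Proof.
move=> sn; rewrite {2}/push_letter.
case: ifP => [nr|/negbFE r]; first by rewrite /push_letter nr.
case: ifP => hd; last first.
  case: ifP => sz; last by rewrite /push_letter r hd sz.
  by rewrite /push_letter reduced_cons hd r /= eqxx.
case: s sn r hd => [//|i s] sn r /eqP[ij]; subst i.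
have := r; rewrite reduced_cons => /andP[/negbTE hd' r'].
by rewrite /push_letter [behead _]/= r' hd' sn.
Qed.

(** A nonempty reduced word of length at most [n], acting on the empty word, writes its letters one
    by one without cancellation or truncation, so it moves the empty word. *)
Lemma exists_large_girth (J : finType) (n : nat) :
  exists (gT : finGroupType) (gen : J -> gT), large_girth gen n.
Proof.
pose act j (s : {bseq n of J}) : {bseq n of J} :=
  Bseq (size_push_letter j (size_bseq s)).
have actK j : involutive (act j).
  by move=> s; apply: val_inj; rewrite /= push_letterK ?size_bseq.
pose gen j : {perm {bseq n of J}} := perm (inv_inj (actK j)).
exists {perm {bseq n of J}}, gen; split=> [j|s rs /andP[s0 sn] E].
  by apply/permP => s; rewrite permM perm1 !permE actK.
(* Products of permutations act from left to right, so the first letter of [w] is pushed first and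
   ends deepest. *)
have walk (w : seq J) (t : {bseq n of J}) : reduced (catrev w t) ->
    (size w + size t <= n)%N -> val (word_prod gen w t) = catrev w t.
  elim: w t => [|j w IH] t /= rw sw; first by rewrite /word_prod big_nil perm1.
  have rjt : reduced (j :: t).
    by move: rw; rewrite catrevE => /cat_sorted2[].
  have vt : val (act j t) = j :: t.
    rewrite /= /push_letter; move: rjt; rewrite reduced_cons => /andP[/negbTE -> ->] /=.
    by rewrite (leq_trans _ sw) // addSn ltnS leq_addl.
  rewrite /word_prod big_cons permM permE.
  by rewrite [LHS]IH vt //= addnS.
have rs' : reduced (catrev s [::]).
  rewrite -/(rev s) /reduced rev_sorted; move: rs; rewrite /reduced.
  by under eq_sorted do rewrite eq_sym.
have := walk s [bseq of [::]] rs'; rewrite addn0 => /(_ sn); rewrite E perm1 -/(rev s) /=.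
by move/(congr1 size); rewrite size_rev /= => s00; rewrite -s00 in s0.
Qed.

Lemma large_girth_neq1 (gT : finGroupType) (J : eqType) (gen : J -> gT) n j :
  large_girth gen n -> (0 < n)%N -> gen j != 1%g.
Proof.
move=> [_ gir] n0; apply/eqP => E; apply: (gir [:: j]) => //.
by rewrite /word_prod big_seq1.
Qed.

Lemma large_girth_inj (gT : finGroupType) (J : eqType) (gen : J -> gT) n :
  large_girth gen n -> (1 < n)%N -> injective gen.
Proof.
move=> [inv gir] n0 i j E; apply/eqP; apply: contraT => ij.
case: (gir [:: i; j]); rewrite /reduced /= ?ij //.
by rewrite /word_prod big_cons big_seq1 E inv.
Qed.

(* A non-backtracking walk inside [U] would revisit a vertex within [#|U|]
   steps, closing a short cycle. *)
Lemma exists_leaf (gT : finGroupType) (J : finType) (gen : J -> gT) n (U : {set gT}) :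
  large_girth gen n -> (#|U| <= n)%N -> U != set0 ->
  exists2 v, v \in U & (#|[set j | (v * gen j)%g \in U]| <= 1)%N.
Proof.
move=> [_ gir] Un /set0Pn[v0 v0U].
case: (boolP [exists v in U, (#|[set j | (v * gen j)%g \in U]| <= 1)%N]) =>
  [/exists_inP[v]|]; first by exists v.
rewrite negb_exists_in => /forall_inP deg2.
have next v j : v \in U -> exists i, (i != j) && ((v * gen i)%g \in U).
  move=> /deg2; rewrite -ltnNge => /card_gt1P[a [b [+ + ab]]]; rewrite !inE => aU bU.
  case: (eqVneq a j) => [aj|aj]; last by exists a; rewrite aj.
  by exists b; rewrite -aj eq_sym ab.
have /card_gt0P[j0 _] : (0 < #|[set j | (v0 * gen j)%g \in U]|)%N.
  by apply: ltnW; rewrite ltnNge; apply: deg2.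
(* A state is the current vertex with the colour of the last edge; the next edge takes another
   colour and stays in [U]. By [next], the fallback [p] never occurs from a vertex of [U]. *)
pose step (p : gT * J) := if [pick i | (i != p.2) && ((p.1 * gen i)%g \in U)] is Some i
  then ((p.1 * gen i)%g, i) else p.
have stepP p : p.1 \in U ->
    [/\ (step p).1 \in U, (step p).2 != p.2 & (step p).1 = (p.1 * gen (step p).2)%g].
  rewrite /step => pU; case: pickP => [i /andP[] //|none].
  by have [i] := next _ p.2 pU; rewrite none.
pose st i := iter i step (v0, j0).
have stU i : (st i).1 \in U by elim: i => //= i /stepP[].
have stE i k : (st (i + k)%N).1 = ((st i).1 * word_prod gen [seq (st l).2 | l <- iota i.+1 k])%g.
  elim: k i => [|k IH] i; first by rewrite addn0 /word_prod big_nil mulg1.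
  rewrite addnS -addSn IH /word_prod /= big_cons mulgA.
  by have [_ _ ->] := stepP _ (stU i).
(* The walk makes [n.+1] visits to at most [n] vertices; between two visits to the same vertex it
   spells a reduced word with product 1. *)
have : ~~ uniq (mkseq (fun i => (st i).1) n.+1).
  apply/negP => u; have := @uniq_leq_size _ _ (enum U) u.
  rewrite size_mkseq -cardE => le; suff: (n.+1 <= #|U|)%N by rewrite ltnNge Un.
  by apply: le => v /mapP[i _ ->]; rewrite mem_enum.
case/(uniqPn 1%g) => i [k [ik]]; rewrite size_mkseq => kn.
rewrite !nth_mkseq // ?(ltn_trans ik) // -(subnKC (ltnW ik)) stE => /eqP.
rewrite eq_sym -{2}[(st i).1]mulg1 (inj_eq (mulgI _)) => /eqP /gir[].
  apply/(sortedP j0) => l; rewrite size_map size_iota => lk.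
  rewrite !(nth_map 0) ?size_iota // ?(ltnW lk) // !nth_iota // ?(ltnW lk) //.
  by rewrite addnS eq_sym; have [] := stepP _ (stU (i.+1 + l)%N).
by rewrite size_map size_iota subn_gt0 ik (leq_trans (leq_subr _ _)).
Qed.

Lemma mulg_eql (gT : finGroupType) (x y : gT) : ((x * y)%g == x) = (y == 1%g).
Proof. by rewrite eq_sym eq_mulVg1 mulKg. Qed.

(** The generators are involutions, so each edge of the Cayley graph is counted from both ends;
    removing [l] removes both contributions of every edge at [l]. *)
Lemma edge_sum_setD1 (gT : finGroupType) (J : finType) (gen : J -> gT) (V : zmodType)
    (phi : J -> gT -> gT -> V) (U : {set gT}) (l : gT) :
  (forall j, gen j * gen j = 1)%g -> (forall j, gen j != 1%g) -> l \in U ->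
  \sum_(v in U) \sum_(j | (v * gen j)%g \in U) phi j v (v * gen j)%g =
  \sum_(v in U :\ l) \sum_(j | (v * gen j)%g \in U :\ l) phi j v (v * gen j)%g +
  \sum_(j | (l * gen j)%g \in U :\ l)
     (phi j l (l * gen j)%g + phi j (l * gen j)%g l).
Proof.
move=> inv neq1 lU; rewrite (big_setD1 l) //= [in RHS]big_split /= [RHS]addrCA.
congr (_ + _).
  by apply: eq_bigl => j; rewrite !inE mulg_eql neq1.
have -> : \sum_(j | (l * gen j)%g \in U :\ l) phi j (l * gen j)%g l =
   \sum_(v in U :\ l) \sum_(j | ((v * gen j)%g == l)) phi j v (v * gen j)%g.
  rewrite (exchange_big_dep predT) //= big_mkcond; apply: eq_bigr => j _.
  case: ifP => lj; last first.
    rewrite big1 // => v /andP[vU /eqP vl].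
    have lv : (l * gen j)%g = v by rewrite -vl -mulgA inv mulg1.
    by move: lj; rewrite lv vU.
  have lK : (l * gen j * gen j)%g = l by rewrite -mulgA inv mulg1.
  rewrite (big_pred1 (l * gen j)%g) ?lK // => v /=.
  apply/andP/eqP => [[_ /eqP<-]|->]; first by rewrite -mulgA inv mulg1.
  by rewrite lj lK.
rewrite -big_split /=; apply: eq_bigr => v vU.
rewrite (bigID (fun j => (v * gen j)%g == l)) /= addrC; congr (_ + _); apply: eq_bigl => j.
  by rewrite !inE andbC.
by case: eqP => [->|]; rewrite ?lU ?andbF.
Qed.

(* Removing a leaf [l] attached by the edge [j] to [p] lowers the form by at
   least [(lam x_l - w_j x_p)^2]. *)
Lemma forest_form_ge0 (R : realFieldType) (gT : finGroupType) (J : finType)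
    (gen : J -> gT) (n : nat) (U : {set gT}) (w : J -> R) (x : gT -> R) (lam : R) :
  large_girth gen n -> (#|U| <= n)%N ->
  0 <= \sum_(v in U) lam ^+ 2 * x v ^+ 2 +
       \sum_(v in U) \sum_(j | (v * gen j)%g \in U)
          (w j ^+ 2 * x v ^+ 2 - lam * w j * x v * x (v * gen j)%g).
Proof.
move=> gir; move cU : #|U| => m; elim: m U cU => [|m IH] U cU mn.
  by rewrite (cards0_eq cU) !big_set0 addr0.
have U0 : U != set0 by rewrite -card_gt0 cU.
have [|l lU deg] := exists_leaf gir _ U0; first by rewrite cU.
pose phi j v v' := w j ^+ 2 * x v ^+ 2 - lam * w j * x v * x v'.
have cU' : #|U :\ l| = m by move: cU; rewrite (cardsD1 l) lU => -[].
have gir1 j : gen j != 1%g by apply: large_girth_neq1 gir (leq_trans _ mn).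
rewrite (edge_sum_setD1 phi gir.1 gir1 lU).
rewrite [X in X + _](big_setD1 l) //=.
set C := (X in _ + (_ + X)).
suff C0 : 0 <= lam ^+ 2 * x l ^+ 2 + C 
  by rewrite [_ + C]addrC addrACA addr_ge0 // (IH _ cU' (ltnW mn)).
rewrite {}/C; case: (set_0Vmem [set j | (l * gen j)%g \in U]) => [E|[j jU]].
  rewrite big_pred0 => [|j]; first by rewrite addr0 -exprMn sqr_ge0.
  by have := in_set0 j; rewrite -E !inE => ->; rewrite andbF.
have E : [set j | (l * gen j)%g \in U] = [set j].
  by apply/eqP; rewrite eq_sym eqEcard sub1set jU cards1.
rewrite (big_pred1 j) => [|i]; last first.
  rewrite !inE mulg_eql gir1 /=.
  by have := in_set1 i j; rewrite -E !inE.
rewrite /phi; set p := x (_ * _)%g.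
have := sqr_ge0 (lam * x l - w j * p); have := sqr_ge0 (w j * x l); nra.
Qed.

(** * The local inequality *)

(* The label [(s, p, e)] adds to side [s] the classes [p] and [p + 1] mod 3; [e]
   makes two copies of each colour. *)
Local Notation label := (bool * 'I_3 * bool)%type.

Definition label_weight (R : pzSemiRingType) (y : bool -> 'I_3 -> R) (j : label) : R :=
  y j.1.1 j.1.2 * y j.1.1 (ordS j.1.2).

Lemma sum_ord3 (V : nmodType) (f : 'I_3 -> V) (p : 'I_3) :
  \sum_q f q = f p + f (ordS p) + f (ordS (ordS p)).
Proof.
rewrite (bigD1 p) // (bigD1 (ordS p)) /=; last by case: p => [[|[|[|]]]].
rewrite (bigD1 (ordS (ordS p))) /=; last by case: p => [[|[|[|]]]].
rewrite big1 ?addr0 ?addrA // => q.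
by case: p q => [[|[|[|]]]] // ? [[|[|[|]]]].
Qed.

Lemma sum_label (V : nmodType) (f : label -> V) :
  \sum_j f j = \sum_s \sum_p (f (s, p, true) + f (s, p, false)).
Proof.
transitivity (\sum_s \sum_p \sum_b f (s, p, b)).
  by rewrite pair_bigA pair_bigA; apply: eq_bigr => -[[s p] b].
by apply: eq_bigr => s _; apply: eq_bigr => p _; rewrite big_bool.
Qed.

(** If [a] is the largest of the three values, the sum is at most [(a (b + c))^2], and AM-GM applies
    to [a] and [b + c]. *)
Lemma sum_sqr_adjacent_le (R : realFieldType) (f : 'I_3 -> R) :
  (forall p, 0 <= f p) ->
  \sum_p (f p * f (ordS p)) ^+ 2 <= (\sum_p f p) ^+ 4 / 16.
Proof.
move=> f0.
have key (a b c : R) : 0 <= a -> 0 <= b -> 0 <= c -> b <= a ->  c <= a ->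
    (a * b) ^+ 2 + (b * c) ^+ 2 + (c * a) ^+ 2 <= (a + b + c) ^+ 4 / 16.
  move=> a0 b0 c0 ba ca.
  have h1 : (a * b) ^+ 2 + (b * c) ^+ 2 + (c * a) ^+ 2 <= (a * (b + c)) ^+ 2.
    suff : b * c * (b * c) <= 2 * (a * a) * (b * c) by lra.
    by apply: ler_wpM2r; rewrite ?mulr_ge0 //; nra.
  apply: le_trans h1 _.
  have h2 : 0 <= a * (b + c) <= (a + b + c) ^+ 2 / 4.
    by apply/andP; split; [rewrite mulr_ge0 ?addr_ge0|have := sqr_ge0 (a - b - c); lra].
  have -> : (a + b + c) ^+ 4 / 16 = ((a + b + c) ^+ 2 / 4) ^+ 2 by field.
  by case/andP: h2 => h2 h3; rewrite lerXn2r ?nnegrE // (le_trans h2).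
have [p pmax] : exists p, forall q, f q <= f p.
  by exists [arg max_(p > ord0) f p]%O; case: arg_maxP => // i _ h q; apply: h.
rewrite (sum_ord3 f p) (sum_ord3 _ p).
have -> : ordS (ordS (ordS p)) = p by apply: val_inj; case: p {pmax} => [[|[|[|]]]].
exact: key.
Qed.

Lemma label_weight_ge0 (R : realFieldType) (y : bool -> 'I_3 -> R) j :
  (forall s p, 0 <= y s p) -> 0 <= label_weight y j.
Proof. by move=> y0; rewrite mulr_ge0. Qed.

Lemma label_weight_le (R : realFieldType) (y : bool -> 'I_3 -> R) j :
  (forall s p, 0 <= y s p) -> label_weight y j <= (\sum_p y j.1.1 p) ^+ 2 / 4.
Proof.
move=> y0; rewrite /label_weight (sum_ord3 _ j.1.2).
have := y0 j.1.1 j.1.2; have := y0 j.1.1 (ordS j.1.2).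
have := y0 j.1.1 (ordS (ordS j.1.2)).
set c := y _ _; set b := y _ _; set a := y _ _ => c0 b0 a0.
have := sqr_ge0 (a - b); have := sqr_ge0 c.
have := mulr_ge0 c0 a0; have := mulr_ge0 c0 b0; lra.
Qed.

(** The denominator is 8 rather than 16 because each colour has two copies. *)
Lemma sum_sqr_label_weight_le (R : realFieldType) (y : bool -> 'I_3 -> R) :
  (forall s p, 0 <= y s p) ->
  \sum_j label_weight y j ^+ 2 <= \sum_s (\sum_p y s p) ^+ 4 / 8.
Proof.
move=> y0; rewrite sum_label; apply: ler_sum => s _.
have := sum_sqr_adjacent_le (y0 s).
rewrite big_split /= /label_weight /=; lra.
Qed.

Lemma sum_offdiag (R : comPzRingType) (I : finType) (x : I -> R) :
  \sum_i \sum_(k | k != i) x i * x k = (\sum_i x i) ^+ 2 - \sum_i x i ^+ 2.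
Proof.
rewrite expr2 mulr_suml -sumrB; apply: eq_bigr => i _.
by rewrite mulr_sumr [in RHS](bigD1 i) //= -expr2 addrAC subrr add0r.
Qed.

(** Distinct colours lead from [g] to distinct cells other than [g], so the gain runs over part of
    the off-diagonal pairs. *)
Lemma gain_le_offdiag (R : realFieldType) (gT : finGroupType) (J : finType)
    (gen : J -> gT) (n : nat) (x : gT -> R) (w : J -> R) (M : R) :
  large_girth gen n -> (1 < n)%N -> (forall g, 0 <= x g) -> (forall j, 0 <= w j <= M) -> 0 <= M ->
  \sum_j \sum_g x g * x (g * gen j)%g * w j <=
  ((\sum_g x g) ^+ 2 - \sum_g x g ^+ 2) * M.
Proof.
move=> gir n1 x0 wM M0; rewrite -sum_offdiag exchange_big /= mulr_suml.
apply: ler_sum => g _; rewrite mulr_suml.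
have injg : injective (fun j => g * gen j)%g.
  by move=> i j /mulgI; apply: (large_girth_inj gir n1).
apply: (@le_trans _ _ (\sum_j x g * x (g * gen j)%g * M)).
  by apply: ler_sum => j _; case/andP: (wM j) => *; rewrite ler_wpM2l ?mulr_ge0.
pose S := [set (g * gen j)%g | j : J].
have -> : \sum_j x g * x (g * gen j)%g * M = \sum_(h in S) x g * x h * M.
  by rewrite big_imset; [apply: eq_bigl => j; rewrite inE | exact: in2W].
rewrite [leRHS]big_mkcond [leLHS]big_mkcond.
apply: ler_sum => h _; case: ifP => [/imsetP[j _ ->]|_].
  by rewrite mulg_eql (large_girth_neq1 _ gir) // ltnW.
by case: ifP => // _; rewrite !mulr_ge0.
Qed.

(** The support induces a forest, and [forest_form_ge0] bounds [lam] times the gain by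
    [lam^2 + sum w_j^2] times the sum of squares; edges leaving the support only add squares to the
    form. *)
Lemma gain_le_forest (R : realFieldType) (gT : finGroupType) (J : finType)
    (gen : J -> gT) (n : nat) (x : gT -> R) (w : J -> R) (lam : R) :
  large_girth gen n -> (#|[set g | x g != 0%R]| <= n)%N -> 0 < lam ->
  \sum_j w j ^+ 2 <= lam ^+ 2 ->
  \sum_j \sum_g x g * x (g * gen j)%g * w j <= 2 * lam * \sum_g x g ^+ 2.
Proof.
move=> gir supp lam0 Dlam; set U := [set g | x g != 0] in supp.
have := forest_form_ge0 w x lam gir supp.
have xU g : g \notin U -> x g = 0 by rewrite inE negbK => /eqP.
have -> : \sum_(v in U) lam ^+ 2 * x v ^+ 2 = lam ^+ 2 * \sum_g x g ^+ 2.
  rewrite mulr_sumr [LHS]big_mkcond; apply: eq_bigr => g _.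
  by case: ifPn => // /xU ->; rewrite expr0n mulr0.
have : \sum_(v in U) \sum_(j | (v * gen j)%g \in U)
   (w j ^+ 2 * x v ^+ 2 - lam * w j * x v * x (v * gen j)%g) <=
   \sum_v \sum_j (w j ^+ 2 * x v ^+ 2 - lam * w j * x v * x (v * gen j)%g).
  rewrite big_mkcond; apply: ler_sum => v _; case: ifPn => [_|/xU ->]; last first.
    by rewrite big1 // => j _; rewrite expr0n !(mulr0, mul0r) subr0.
  rewrite big_mkcond; apply: ler_sum => j _; case: ifPn => [//|/xU ->].
  by rewrite mulr0 subr0 -exprMn sqr_ge0.
have -> : \sum_v \sum_j (w j ^+ 2 * x v ^+ 2 - lam * w j * x v * x (v * gen j)%g) =
   (\sum_j w j ^+ 2) * \sum_g x g ^+ 2 -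
   lam * \sum_j \sum_g x g * x (g * gen j)%g * w j.
  rewrite mulr_suml mulr_sumr -sumrB exchange_big; apply: eq_bigr => j _ /=.
  by rewrite !mulr_sumr -sumrB; apply: eq_bigr => g _; ring.
set Q := \sum_j \sum_g _; set s := \sum_g x g ^+ 2; set D := \sum_j _ in Dlam *.
move=> le1 le2; rewrite -(ler_pM2l lam0).
have s0 : 0 <= s by apply: sumr_ge0 => g _; apply: sqr_ge0.
have := ler_wpM2r s0 Dlam; nra.
Qed.

(** With [x] and [y] the vertex counts of the cells and classes, the left side is twice the number
    of ways to choose the four vertices of an edge in [V1], [V2] and [V3]. *)
Lemma local_inequality (R : realFieldType) (gT : finGroupType)
    (gen : label -> gT) (n : nat) (x : gT -> R) (y : bool -> 'I_3 -> R) :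
  large_girth gen n -> (1 < n)%N ->
  (forall g, 0 <= x g) -> (forall s p, 0 <= y s p) ->
  (#|[set g | x g != 0%R]| <= n)%N ->
  (\sum_g \sum_(h | h != g) x g * x h) * ((\sum_p y false p) * \sum_p y true p) +
    \sum_j \sum_g x g * x (g * gen j)%g * label_weight y j <=
  (\sum_g x g) ^+ 2 * (\sum_s \sum_p y s p) ^+ 2 / 4.
Proof.
move=> gir n1 x0 y0 supp; rewrite sum_offdiag big_bool /=.
set G := (X in _ + X <= _); set X := \sum_g x g; set s := \sum_g x g ^+ 2.
set u := \sum_p y false p; set v := \sum_p y true p.
have u0 : 0 <= u by apply: sumr_ge0.
have v0 : 0 <= v by apply: sumr_ge0.
have X0 : 0 <= X by apply: sumr_ge0.
have s0 : 0 <= s by apply: sumr_ge0 => g _; apply: sqr_ge0.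
have off : 0 <= X ^+ 2 - s.
  by rewrite -sum_offdiag; do 2![apply: sumr_ge0 => ? _]; rewrite mulr_ge0.
have gainM M : 0 <= M -> u ^+ 2 / 4 <= M -> v ^+ 2 / 4 <= M -> G <= (X ^+ 2 - s) * M.
  move=> M0 uM vM; apply: (gain_le_offdiag gir n1 x0 _ M0) => j.
  rewrite label_weight_ge0 //=; apply: le_trans (label_weight_le _ y0) _.
  by case: j.1.1.
case: (ltrP (4 * s) (X ^+ 2)) => sX; last first.
  wlog uv : u v u0 v0 gainM / v <= u => [wl|].
    case: (leP v u) => [|/ltW] uv; first exact: wl.
    rewrite [u * v]mulrC [v + u]addrC; apply: wl => // M M0 *; exact: gainM.
  have uv2 : v ^+ 2 <= u ^+ 2 by rewrite lerXn2r ?nnegrE.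
  have u2 := sqr_ge0 u.
  have GM : G <= (X ^+ 2 - s) * (u ^+ 2 / 4) by apply: gainM; lra.
  (* The factor 1/3, sharp at [u = 2 v], times the 3/4 coming from [s >= X^2 / 4] gives exactly the
     required 1/4. *)
  have h1 : u * v + u ^+ 2 / 4 <= (u + v) ^+ 2 / 3 by have := sqr_ge0 (u - 2 * v); lra.
  have h2 := ler_wpM2l off h1.
  have h3 : (X ^+ 2 - s) * ((v + u) ^+ 2 / 3) <= (3 / 4 * X ^+ 2) * ((v + u) ^+ 2 / 3).
    by apply: ler_wpM2r; [have := sqr_ge0 (v + u); lra | lra].
  lra.
case: (ltrP 0 (u + v)) => uv0; last first.
  have u00 : u = 0 by lra.
  have v00 : v = 0 by lra.
  have := gainM 0; rewrite u00 v00 => h; have {}h : G <= (X ^+ 2 - s) * 0 by apply: h; lra.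
  lra.
(* With this value, gain minus loss is at most [s (u - v)^2]. *)
pose lam := (u ^+ 2 + v ^+ 2 - u * v) / 2.
have lam0 : 0 < lam.
  have := exprn_gt0 2 uv0; have := sqr_ge0 (u - v); rewrite /lam; lra.
have D : \sum_j label_weight y j ^+ 2 <= lam ^+ 2.
  apply: le_trans (sum_sqr_label_weight_le y0) _; rewrite big_bool /= -/u -/v.
  (* The difference of the two sides is exactly [(u - v)^4 / 8]. *)
  have := sqr_ge0 ((u - v) ^+ 2); rewrite /lam; lra.
have := gain_le_forest gir supp lam0 D; rewrite -/G -/s /lam => Gs.
have := ler_wpM2r (sqr_ge0 (u - v)) (ltW sX); lra.
Qed.

(** * The construction *)

(* The cells of [V1] are indexed by [gT], the classes of [V2] ([false]) and [V3]
   ([true]) by [bool * 'I_3], and [V4], ..., [V(r-1)] by ['I_k]. *)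
Definition vertex (gT : finGroupType) (k a b c : nat) : finType :=
  (gT * 'I_a + bool * 'I_3 * 'I_b + 'I_k * 'I_c)%type.

(* [None] stands for the edges of the pattern, [Some j] for the added ones. *)
Definition pair_ok (gT : finGroupType) (gen : label -> gT) (o : option label) (g h : gT) : bool :=
  if o is Some j then h == (g * gen j)%g else h != g.

Definition link_ok (o : option label) (y z : bool * 'I_3) : bool :=
  if o is Some j then (y == (j.1.1, j.1.2)) && (z == (j.1.1, ordS j.1.2))
  else (y.1 == false) && (z.1 == true).

Definition config (gT : finGroupType) (k a b c : nat) : finType :=
  (option label * ((gT * 'I_a) * (gT * 'I_a)) *
   ((bool * 'I_3 * 'I_b) * (bool * 'I_3 * 'I_b)) * {ffun 'I_k -> 'I_c})%type.

(* The ranks pick one of the two orders of the vertices in [V1], so that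
   [edge_of] is injective on [configs]. *)
Definition configs (gT : finGroupType) (gen : label -> gT) (k a b c : nat) :
    {set config gT k a b c} :=
  [set t : config gT k a b c | let: (o, x, y, _) := t in
    [&& (enum_rank x.1 < enum_rank x.2)%N, pair_ok gen o x.1.1 x.2.1 & link_ok o y.1.1 y.2.1]].

Definition edge_of (gT : finGroupType) (k a b c : nat) (t : config gT k a b c) :
    {set vertex gT k a b c} :=
  let: (_, x, y, h) := t in
  [set z : vertex gT k a b c | match z with
    | inl (inl v) => (v == x.1) || (v == x.2)
    | inl (inr v) => (v == y.1) || (v == y.2)
    | inr v => v.2 == h v.1
    end].

Lemma link_ok_neq o y z : link_ok o y z -> y != z.
Proof.
case: o => [[[s p] e]|]; case: y z => [sy py] [sz pz] /=.
  by case/andP => /eqP-> /eqP->; apply/eqP => -[]; case: p => [[|[|[|]]]].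
by case/andP => /eqP-> /eqP->.
Qed.

Lemma link_ok_side o y z : link_ok o y z -> (y.1 == z.1) = isSome o.
Proof. by case: o => [j|] /= /andP[/eqP-> /eqP->] //=; rewrite eqxx. Qed.

Lemma link_ok_asym o y z : link_ok o y z -> link_ok o z y = false.
Proof.
case: o => [[[s p] e]|]; case: y z => [sy py] [sz pz] /=.
  by case/andP => /eqP-> /eqP->; apply/negP => /andP[/eqP[]]; case: p => [[|[|[|]]]].
by case/andP => /eqP-> /eqP->.
Qed.

Lemma pair_ok_sym (gT : finGroupType) (gen : label -> gT) o g h :
  (forall j, gen j * gen j = 1)%g -> pair_ok gen o g h = pair_ok gen o h g.
Proof.
move=> inv; case: o => [j|] /=; last by rewrite eq_sym.
by apply/eqP/eqP => ->; rewrite -mulgA inv mulg1.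
Qed.

Lemma pair_ok_irrefl (gT : finGroupType) (gen : label -> gT) n o g :
  large_girth gen n -> (0 < n)%N -> pair_ok gen o g g = false.
Proof.
move=> gir n0; case: o => [j|] /=; last by rewrite eqxx.
by rewrite eq_sym mulg_eql; apply/negbTE; apply: large_girth_neq1 gir n0.
Qed.

Lemma card_edge_of (gT : finGroupType) (gen : label -> gT) (k a b c : nat)
    (t : config gT k a b c) :
  t \in configs gen k a b c -> #|edge_of t| = k.+4.
Proof.
case: t => [[[o [x1 x2]] [y1 y2]] h]; rewrite inE => /and3P[/= rk _ lk].
rewrite -sum1_card big_sumType /= big_sumType /=.
under eq_bigl do rewrite inE.
under [X in (_ + X + _)%N]eq_bigl do rewrite inE.
under [X in (_ + X)%N]eq_bigl do rewrite inE.
have x12 : x1 != x2 by apply: contraTneq rk => ->; rewrite ltnn.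
have y12 : y1 != y2 by apply: contraTneq (link_ok_neq lk) => ->; rewrite eqxx.
rewrite !sum1_card.
rewrite (_ : #|_| = 2); last by rewrite -[RHS](_ : #|pred2 x1 x2| = 2) ?card2 ?x12.
rewrite (_ : #|_| = 2); last by rewrite -[RHS](_ : #|pred2 y1 y2| = 2) ?card2 ?y12.
rewrite -sum1_card -(pair_big_dep predT (fun i j => j == h i) (fun _ _ => 1%N)) /=.
under eq_bigr do rewrite big_pred1_eq.
by rewrite sum1_card card_ord.
Qed.

(** The ranks order the two vertices in [V1]. The other pair lies on one side exactly for added
    edges; their label is then the colour joining the two cells. Since [p + 2] differs from [p] mod
    3, the label also orders that pair. *)
Lemma edge_of_inj (gT : finGroupType) (gen : label -> gT) (k a b c n : nat) :
  large_girth gen n -> (1 < n)%N ->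
  {in configs gen k a b c &, injective (@edge_of gT k a b c)}.
Proof.
move=> gir n1 [[[o [x1 x2]] [y1 y2]] h] [[[o' [x1' x2']] [y1' y2']] h'].
rewrite !inE /= => /and3P[rk pk lk] /and3P[rk' pk' lk'] /setP E.
have EA v : (v == x1) || (v == x2) = (v == x1') || (v == x2').
  by have := E (inl (inl v)); rewrite !inE.
have EB v : (v == y1) || (v == y2) = (v == y1') || (v == y2').
  by have := E (inl (inr v)); rewrite !inE.
have -> : h = h'.
  apply/ffunP => i; have := E (inr (i, h i)); rewrite !inE /= eqxx => /esym/eqP //.
have [ex1 ex2] : x1 = x1' /\ x2 = x2'.
  have := EA x1; have := EA x2; rewrite !eqxx orbT /=.
  move=> /esym/orP[/eqP e2|/eqP e2] /esym/orP[/eqP e1|/eqP e1] //.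
  - by move: rk; rewrite e1 e2 ltnn.
  - by move: rk rk'; rewrite e1 e2 => /ltn_trans /[apply]; rewrite ltnn.
  - by move: rk; rewrite e1 e2 ltnn.
subst x1' x2'.
have oE : isSome o = isSome o' -> o = o'.
  case: o o' pk pk' {lk lk'} => [j|] [j'|] //= /eqP-> /eqP /mulgI e _.
  by rewrite (large_girth_inj gir n1 e).
have [[ey1 ey2]|[ey1 ey2]] : (y1 = y1' /\ y2 = y2') \/ (y1 = y2' /\ y2 = y1').
  have y12 : y1 != y2 by apply: contraTneq (link_ok_neq lk) => ->; rewrite eqxx.
  have := EB y1; have := EB y2; rewrite !eqxx orbT /=.
  move=> /esym/orP[/eqP e2|/eqP e2] /esym/orP[/eqP e1|/eqP e1] //.
  - by move: y12; rewrite e1 e2 eqxx.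
  - by right.
  - by left.
  - by move: y12; rewrite e1 e2 eqxx.
all: subst y1' y2'.
  by rewrite oE // -(link_ok_side lk) (link_ok_side lk').
have eo : o = o' by apply: oE; rewrite -(link_ok_side lk) -(link_ok_side lk') eq_sym.
by have := link_ok_asym lk; rewrite eo lk'.
Qed.

(** * Counting the edges inside a vertex set *)

Definition cell_in (gT : finGroupType) (k a b c : nat) (S : {set vertex gT k a b c})
    (g : gT) : nat :=
  #|[set i : 'I_a | inl (inl (g, i)) \in S]|.

Definition links_in (gT : finGroupType) (k a b c : nat) (S : {set vertex gT k a b c})
    (s : bool) (p : 'I_3) : nat :=
  #|[set i : 'I_b | inl (inr (s, p, i)) \in S]|.

Definition layer_in (gT : finGroupType) (k a b c : nat) (S : {set vertex gT k a b c})
    (l : 'I_k) : nat :=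
  #|[set i : 'I_c | inr (l, i) \in S]|.

Lemma sum_ranked_pairs (I : finType) (F : I -> I -> nat) :
  (forall i k, F i k = F k i) -> (forall i, F i i = 0%N) ->
  (2 * (\sum_i \sum_k (enum_rank i < enum_rank k) * F i k) = \sum_i \sum_k F i k)%N.
Proof.
move=> sym irr; rewrite mulSn mul1n {2}exchange_big /= -big_split; apply: eq_bigr => i _.
rewrite -big_split; apply: eq_bigr => k _ /=; rewrite [F k i]sym -mulnDl.
have [->|ik] := eqVneq i k; first by rewrite irr muln0.
have : enum_rank i != enum_rank k by rewrite (inj_eq enum_rank_inj).
by rewrite -val_eqE /= neq_ltn => /orP[] h; rewrite h ltnNge (ltnW h) ?mul1n // !mul1n.
Qed.

Lemma sum_card_fibers (I K : finType) (P : I * K -> bool) :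
  (\sum_(z | P z) 1 = \sum_i #|[set k | P (i, k)]|)%N.
Proof.
transitivity (\sum_i \sum_(k | P (i, k)) 1)%N.
  by rewrite pair_big_dep; apply: eq_bigl => -[].
by apply: eq_bigr => i _; rewrite -sum1_card; apply: eq_bigl => k; rewrite inE.
Qed.

Lemma card_vertex_set (gT : finGroupType) (k a b c : nat) (S : {set vertex gT k a b c}) :
  #|S| = (\sum_g cell_in S g + \sum_s \sum_p links_in S s p + \sum_l layer_in S l)%N.
Proof.
rewrite -sum1_card big_sumType /= big_sumType /= !sum_card_fibers; congr (_ + _ + _)%N.
by rewrite pair_bigA; apply: eq_bigr => -[].
Qed.

Lemma sum_fibers (I K : finType) (A : pred (I * K)) (F : I -> nat) :
  (\sum_z A z * F z.1 = \sum_i #|[set k | A (i, k)]| * F i)%N.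
Proof.
transitivity (\sum_i \sum_k A (i, k) * F i)%N.
  by rewrite pair_bigA; apply: eq_bigr => -[].
apply: eq_bigr => i _; rewrite -big_distrl /= -sum1_card [in RHS]big_mkcond; congr (_ * _)%N.
by apply: eq_bigr => k _; rewrite inE; case: (A _).
Qed.

Lemma sum_fibers2 (I K : finType) (A : pred (I * K)) (F : I -> I -> nat) :
  (\sum_x \sum_z A x * A z * F x.1 z.1 =
   \sum_i \sum_l #|[set k | A (i, k)]| * #|[set k | A (l, k)]| * F i l)%N.
Proof.
transitivity (\sum_x A x * \sum_l #|[set k | A (l, k)]| * F x.1 l)%N.
  apply: eq_bigr => x _; rewrite -sum_fibers big_distrr /=.
  by apply: eq_bigr => z _; rewrite mulnA.
rewrite (sum_fibers A (fun i => \sum_l #|[set k | A (l, k)]| * F i l)%N).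
by apply: eq_bigr => i _; rewrite big_distrr /=; apply: eq_bigr => l _; rewrite mulnA.
Qed.

Lemma sum_option (I : finType) (F : option I -> nat) :
  (\sum_o F o = F None + \sum_i F (Some i))%N.
Proof.
rewrite (bigD1 None) //=; congr (_ + _)%N.
rewrite (reindex_omap Some id) => [|[i|]] //=.
by apply: eq_bigl => i; rewrite eqxx.
Qed.

Lemma edge_of_subset (gT : finGroupType) (k a b c : nat) (S : {set vertex gT k a b c}) o x y h :
  (@edge_of gT k a b c (o, x, y, h) \subset S) =
  [&& inl (inl x.1) \in S, inl (inl x.2) \in S, inl (inr y.1) \in S, inl (inr y.2) \in S &
      [forall l, inr (l, h l) \in S]].
Proof.
apply/subsetP/and5P => [sub|[Sx1 Sx2 Sy1 Sy2 /forallP Sh] [[v|v]|[l i]]].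
- split; try by apply: sub; rewrite !inE eqxx ?orbT.
  by apply/forallP => l; apply: sub; rewrite !inE.
- by rewrite inE => /orP[] /eqP->.
- by rewrite inE => /orP[] /eqP->.
- by rewrite inE => /eqP /= ->.
Qed.

Lemma card_layers (gT : finGroupType) (k a b c : nat) (S : {set vertex gT k a b c}) :
  (\sum_(h : {ffun 'I_k -> 'I_c}) [forall l, inr (l, h l) \in S] = \prod_l layer_in S l)%N.
Proof.
transitivity (\prod_(l : 'I_k) \sum_(i : 'I_c) (inr (l, i) \in S : nat))%N; last first.
  apply: eq_bigr => l _; rewrite /layer_in -sum1_card [RHS]big_mkcond.
  by apply: eq_bigr => i _; rewrite inE; case: (_ \in S).
rewrite bigA_distr_bigA /=; apply: eq_bigr => h _.
case: (boolP [forall l, _]) => [/forallP Sh|]; first by rewrite big1 // => l _; rewrite Sh.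
by rewrite negb_forall => /existsP[l /negbTE Sl]; rewrite (bigD1 l) //= Sl.
Qed.

(** Once [o] is fixed, the pair in [V1], the pair in [V2] and [V3], and the layer vertices are
    chosen independently. The factor 2 undoes the ranking of the pair in [V1]. *)
Lemma card_configs_in (gT : finGroupType) (gen : label -> gT) (k a b c n : nat)
    (S : {set vertex gT k a b c}) :
  large_girth gen n -> (0 < n)%N ->
  (2 * #|[set t in configs gen k a b c | edge_of t \subset S]| =
   ((\sum_g \sum_(h | h != g) cell_in S g * cell_in S h) *
      ((\sum_p links_in S false p) * \sum_p links_in S true p) +
    \sum_j \sum_g cell_in S g * cell_in S (g * gen j)%g * label_weight (links_in S) j) *
   \prod_l layer_in S l)%N.
Proof.
move=> gir n0.
pose A (x : gT * 'I_a) := inl (inl x) \in S.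
pose B (y : bool * 'I_3 * 'I_b) := inl (inr y) \in S.
pose NA o := (\sum_x \sum_z A x * A z * pair_ok gen o x.1 z.1)%N.
pose NB o := (\sum_y \sum_z B y * B z * link_ok o y.1 z.1)%N.
have -> : #|[set t in configs gen k a b c | edge_of t \subset S]| =
   (\sum_o (\sum_x \sum_z (enum_rank x < enum_rank z) * (A x * A z * pair_ok gen o x.1 z.1)) *
      NB o * \prod_l layer_in S l)%N.
  rewrite -sum1_card big_mkcond /=.
  pose P (t : config gT k a b c) := t \in [set t in configs gen k a b c | edge_of t \subset S].
  transitivity (\sum_o \sum_x \sum_y \sum_h P (o, x, y, h))%N.
    rewrite !pair_bigA /config; apply: eq_bigr => -[[[o x] y] h] _.
    by have ifb (e : bool) : (if e then 1 else 0)%N = e; [case: e | rewrite ifb].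
  apply: eq_bigr => o _; rewrite -card_layers /NB ![in RHS]pair_bigA big_distrlr /= big_distrl.
  apply: eq_bigr => x _; rewrite big_distrlr; apply: eq_bigr => y _; apply: eq_bigr => h _ /=.
  rewrite /P !in_set edge_of_subset /A /B; rewrite !mulnb -!andbA; congr nat_of_bool.
  by case: (_ < _)%N => //=; case: (pair_ok _ _ _ _); case: (link_ok _ _ _);
    do 4!case: (inl _ \in S).
rewrite big_distrr /=.
have -> : (\sum_o 2 * ((\sum_x \sum_z (enum_rank x < enum_rank z) *
   (A x * A z * pair_ok gen o x.1 z.1)) * NB o * \prod_l layer_in S l) =
   \sum_o NA o * NB o * \prod_l layer_in S l)%N.
  apply: eq_bigr => o _; rewrite !mulnA sum_ranked_pairs // => [x z|x].
    by rewrite (pair_ok_sym _ _ _ gir.1) [(A x * _)%N]mulnC.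
  by rewrite (pair_ok_irrefl _ _ gir n0) muln0.
rewrite -big_distrl /= sum_option; congr ((_ + _) * _)%N.
  rewrite /NA /NB (sum_fibers2 A (fun g h => h != g : nat)).
  rewrite (sum_fibers2 B (fun y z => (y.1 == false) && (z.1 == true) : nat)).
  congr (_ * _)%N.
    apply: eq_bigr => g _; rewrite [RHS]big_mkcond; apply: eq_bigr => h _.
    by case: eqP; rewrite ?muln0 ?muln1.
  have sum_side (F : bool * 'I_3 -> nat) :
      (\sum_y F y = \sum_p F (true, p) + \sum_p F (false, p))%N.
    transitivity (\sum_s \sum_p F (s, p))%N; last exact: big_bool.
    by rewrite pair_bigA; apply: eq_bigr => -[].
  rewrite big_distrlr /= sum_side big1 => [|p _]; last by rewrite big1 // => z _; rewrite muln0.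
  apply: eq_bigr => p _; rewrite sum_side [X in (_ + X)%N]big1 => [|q _]; last by rewrite muln0.
  by rewrite addn0; apply: eq_bigr => q _; rewrite muln1.
apply: eq_bigr => j _; rewrite /NA /NB (sum_fibers2 A (fun g h => h == g * gen j : nat)%g).
rewrite (sum_fibers2 B (fun y z => (y == (j.1.1, j.1.2)) && (z == (j.1.1, ordS j.1.2)) : nat)).
rewrite -big_distrl /=; congr (_ * _)%N.
  apply: eq_bigr => g _; rewrite (bigD1 (g * gen j)%g) //= eqxx muln1 big1 ?addn0 // => h.
  by move/negbTE => ->; rewrite muln0.
rewrite (bigD1 (j.1.1, j.1.2)) //= [X in (_ + X)%N]big1 => [|y /negbTE yj]; last first.
  by rewrite big1 // => z _; rewrite yj muln0.
rewrite (bigD1 (j.1.1, ordS j.1.2)) //= !eqxx muln1 big1 ?addn0 // => z /negbTE ->.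
by rewrite andbF muln0.
Qed.

(** * Densities *)

Lemma natr_card_configs_in (R : comPzRingType) (gT : finGroupType) (gen : label -> gT)
    (k a b c n : nat) (S : {set vertex gT k a b c}) :
  large_girth gen n -> (0 < n)%N ->
  2 * #|[set t in configs gen k a b c | edge_of t \subset S]|%:R =
  ((\sum_g \sum_(h | h != g) (cell_in S g)%:R * (cell_in S h)%:R) *
      ((\sum_p (links_in S false p)%:R) * \sum_p (links_in S true p)%:R) +
    \sum_j \sum_g (cell_in S g)%:R * (cell_in S (g * gen j)%g)%:R *
       label_weight (fun s p => (links_in S s p)%:R) j) *
   \prod_l (layer_in S l)%:R :> R.
Proof.
move=> gir n0; rewrite -natrM (card_configs_in _ gir n0) natrM natrD !natrM !natr_sum natr_prod.
congr ((_ * _ + _) * _).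
  by apply: eq_bigr => g _; rewrite natr_sum; apply: eq_bigr => h _; rewrite natrM.
by apply: eq_bigr => j _; rewrite natr_sum; apply: eq_bigr => g _; rewrite !natrM.
Qed.

(** AM-GM for [k.+4] numbers: [x / 2] twice, [w / 2] twice, and the [l i]. *)
Lemma prod4_le_mean (R : realFieldType) (k : nat) (x w : R) (l : 'I_k -> R) :
  0 <= x -> 0 <= w -> (forall i, 0 <= l i) ->
  (x / 2) ^+ 2 * (w / 2) ^+ 2 * \prod_i l i <= ((x + w + \sum_i l i) / k.+4%:R) ^+ k.+4.
Proof.
move=> x0 w0 l0.
pose E (i : bool + bool + 'I_k) :=
  match i with inl (inl _) => x / 2 | inl (inr _) => w / 2 | inr i => l i end.
have E0 : {in predT, forall i, 0 <= E i}.
  by move=> [[e|e]|i] _ //=; rewrite divr_ge0.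
have cI : #|{: bool + bool + 'I_k}| = k.+4 by rewrite card_sum card_sum card_bool card_ord.
have := (leif_AGM E0).1; rewrite cI.
rewrite !(big_sumType, big_bool) /= !expr2.
by rewrite -!splitr.
Qed.

(** By the local inequality, twice the count is at most [x^2 w^2 / 4] times the product of the
    layers, and [prod4_le_mean] bounds this. Girth [#|S|] suffices, as [S] meets at most [#|S|]
    cells. *)
Lemma configs_in_le (R : realFieldType) (gT : finGroupType) (gen : label -> gT)
    (k a b c : nat) (S : {set vertex gT k a b c}) :
  large_girth gen #|S| -> (1 < #|S|)%N ->
  #|[set t in configs gen k a b c | edge_of t \subset S]|%:R <=
  2 * (#|S|%:R / k.+4%:R) ^+ k.+4 :> R.
Proof.
move=> gir n1.
have nE := natr_card_configs_in R S gir (ltnW n1).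
have supp : (#|[set g | (cell_in S g)%:R != 0%R :> R]| <= #|S|)%N.
  rewrite [leqRHS]card_vertex_set -addnA; apply: leq_trans (leq_addr _ _).
  rewrite -sum1_card big_mkcond; apply: leq_sum => g _.
  by rewrite inE pnatr_eq0 -lt0n; case: ltnP.
have := @local_inequality R gT gen _ (fun g => (cell_in S g)%:R)
  (fun s p => (links_in S s p)%:R) gir n1 (fun _ => ler0n _ _) (fun _ _ => ler0n _ _) supp.
set N4 := (X in X <= _) in nE *.
have -> : #|S|%:R = \sum_g (cell_in S g)%:R + \sum_s \sum_p (links_in S s p)%:R +
     \sum_l (layer_in S l)%:R :> R.
  rewrite card_vertex_set !natrD !natr_sum; congr (_ + _ + _).
  by apply: eq_bigr => s _; rewrite natr_sum.
set x := \sum_g (cell_in S g)%:R; set w := \sum_s \sum_p (links_in S s p)%:R => N4le.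
have x0 : 0 <= x by apply: sumr_ge0 => *; apply: ler0n.
have w0 : 0 <= w by do 2!apply: sumr_ge0 => ? _; apply: ler0n.
have := prod4_le_mean x0 w0 (fun i => ler0n R (layer_in S i)).
set l := \prod_i _ in nE * => am.
have l0 : 0 <= l by apply: prodr_ge0 => *; apply: ler0n.
have := ler_wpM2r l0 N4le; rewrite -nE; lra.
Qed.

(** The sizes give [V1] order [2 L] and every other part order [L]. Relative to [2 L^r], the cells
    cost [1/t] and the 12 colours return [4/(3t)]. *)
Lemma card_configs (R : realFieldType) (gT : finGroupType) (gen : label -> gT) (k m n : nat) :
  large_girth gen n -> (0 < n)%N ->
  let t := #|gT| in let L := (3 * (t * m))%N in
  #|configs gen k (6 * m) (t * m) L|%:R =
  2 * L%:R ^+ k.+4 * (1 + (3 * t%:R)^-1) :> R.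
Proof.
move=> gir n0 t L; set C := configs _ _ _ _ _.
have t0 : t%:R != 0 :> R by rewrite pnatr_eq0 -lt0n; apply/card_gt0P; exists 1%g.
have := natr_card_configs_in R (setT : {set vertex gT k (6 * m) (t * m) L}) gir n0.
have -> : [set x in C | edge_of x \subset setT] = C.
  by apply/setP => x; rewrite inE subsetT andbT.
have pE g : cell_in (setT : {set vertex gT k (6 * m) (t * m) L}) g = (6 * m)%N.
  by rewrite /cell_in -[RHS]card_ord -cardsT; apply: eq_card => i; rewrite !inE.
have lE s p : links_in (setT : {set vertex gT k (6 * m) (t * m) L}) s p = (t * m)%N.
  by rewrite /links_in -[RHS]card_ord -cardsT; apply: eq_card => i; rewrite !inE.
have cE i : layer_in (setT : {set vertex gT k (6 * m) (t * m) L}) i = L.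
  by rewrite /layer_in -[RHS]card_ord -cardsT; apply: eq_card => j; rewrite !inE.
have cst (I : finType) (F : I -> R) z : (forall i, F i = z) -> \sum_i F i = #|I|%:R * z.
  by move=> Fz; rewrite (eq_bigr _ (fun i _ => Fz i)) sumr_const mulr_natl.
rewrite sum_offdiag.
rewrite (cst _ _ (6 * m)%:R) => [|g]; last by rewrite pE.
rewrite (cst _ _ ((6 * m)%:R ^+ 2)) => [|g]; last by rewrite pE.
rewrite (cst _ _ (t * m)%:R) => [|p]; last by rewrite lE.
rewrite (cst _ _ (t * m)%:R) => [|p]; last by rewrite lE.
rewrite (cst _ _ (t%:R * ((6 * m)%:R * (6 * m)%:R * ((t * m)%:R * (t * m)%:R)))); last first.
  by move=> j; apply: cst => g; rewrite !pE /label_weight !lE.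
rewrite (eq_bigr (fun _ => L%:R)) => [|l _]; last by rewrite cE.
rewrite prodr_const !card_prod card_bool !card_ord -/t /L !natrM => E.
apply: (@mulfI _ (2 : R)); [by rewrite pnatr_eq0 | rewrite E !exprS; field].
by rewrite t0.
Qed.

(** This is [n^_r >= n^r (1 - r^2 / n)], multiplied by [n] to avoid division. *)
Lemma ffactn_ge (R : realFieldType) (n r : nat) :
  (r <= n)%N -> n%:R ^+ r.+1 - r%:R ^+ 2 * n%:R ^+ r <= n%:R * (n ^_ r)%:R :> R.
Proof.
elim: r => [|r IH] rn; first by rewrite ffactn0 !mulr1 expr1 mulr0n expr0n subr0.
rewrite ffactnSr natrM natrB ?(ltnW rn) //.
have {}IH := IH (ltnW rn).
have nr : 0 <= n%:R - r%:R :> R by rewrite subr_ge0 ler_nat ltnW.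
have := ler_wpM2r nr IH; rewrite -[r.+1%:R]natr1 !exprS.
have := ler0n R r; have := ler0n R n; have := exprn_ge0 r (ler0n R n).
set N := n%:R; set p := r%:R; set z := N ^+ r => z0 N0 p0.
have : 0 <= z * (p * p * p) by rewrite !mulr_ge0.
have : 0 <= N * z * p by rewrite !mulr_ge0.
have : 0 <= N * z by rewrite !mulr_ge0.
lra.
Qed.

Lemma two_fact_lt_expn (k : nat) : (2 * k.+4`! < k.+4 ^ k.+4)%N.
Proof.
elim: k => [//|k IH]; rewrite factS mulnCA expnS ltn_pmul2l //.
by apply: leq_trans IH _; rewrite leq_exp2r.
Qed.

Lemma edges_of_configs_sub (gT : finGroupType) (gen : label -> gT) (k a b c : nat) :
  @edge_of gT k a b c @: configs gen k a b c \subset rsubsets k.+4 setT.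
Proof.
by apply/subsetP => _ /imsetP[t tC ->]; rewrite inE subsetT (card_edge_of tC) eqxx.
Qed.

Definition config_rgraph (gT : finGroupType) (gen : label -> gT) (k a b c : nat) :
    Defs.rgraph k.+4 (vertex gT k a b c) :=
  RGraph (edges_of_configs_sub gen k a b c).

Lemma card_vertex (gT : finGroupType) (k m : nat) :
  #|vertex gT k (6 * m) (#|gT| * m) (3 * (#|gT| * m))| = (k.+4 * (3 * (#|gT| * m)))%N.
Proof.
rewrite !card_sum !card_prod card_bool !card_ord.
by move: #|gT| => t; rewrite -(addn4 k); nia.
Qed.

Lemma card_rsubsets (T : finType) (r : nat) (S : {set T}) : #|rsubsets r S| = 'C(#|S|, r).
Proof. exact: cards_draws. Qed.

Lemma natr_bin_fact (R : pzSemiRingType) (n r : nat) :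
  'C(n, r)%:R * r`!%:R = (n ^_ r)%:R :> R.
Proof. by rewrite -natrM bin_ffact. Qed.

Lemma ffactn_le_expn (n r : nat) : (n ^_ r <= n ^ r)%N.
Proof. by elim: r => [|r IH] //; rewrite ffactnSr expnSr leq_mul ?leq_subr. Qed.

(** The order is [r L], and ['C(r L, r)] is at most [(r L)^r / r!]. *)
Lemma density_config_rgraph (R : realType) (gT : finGroupType) (gen : label -> gT)
    (k m n : nat) :
  large_girth gen n -> (1 < n)%N -> (0 < m)%N ->
  2 * (k.+4`!%:R / k.+4%:R ^+ k.+4) * (1 + (3 * #|gT|%:R)^-1) <=
  density R (config_rgraph gen k (6 * m) (#|gT| * m) (3 * (#|gT| * m))).
Proof.
move=> gir n1 m0; have t0 : (0 < #|gT|)%N by apply/card_gt0P; exists 1%g.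
rewrite /density /= card_in_imset; last exact: edge_of_inj gir n1.
rewrite (card_configs R k m gir (ltnW n1)) card_rsubsets cardsT card_vertex.
set L := (3 * _)%N; set r := k.+4; set e := 1 + _.
have L0 : (0 < L)%N by rewrite !muln_gt0 t0 m0.
have e0 : 0 <= e by rewrite addr_ge0 // invr_ge0 mulr_ge0.
have bin0 : 0 < 'C(r * L, r)%:R :> R.
  by rewrite ltr0n bin_gt0 leq_pmulr.
have key : r`!%:R / r%:R ^+ r * 'C(r * L, r)%:R <= L%:R ^+ r :> R.
  rewrite mulrAC ler_pdivrMr ?exprn_gt0 ?ltr0n // mulrC.
  by rewrite natr_bin_fact -exprMn -natrM -natrX ler_nat mulnC ffactn_le_expn.
have e2 : 0 <= 2 * e by rewrite mulr_ge0.
by rewrite ler_pdivlMr //; have := ler_wpM2l e2 key; lra.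
Qed.

Lemma density_subgraph_le (R : realType) (gT : finGroupType) (gen : label -> gT)
    (k a b c n : nat) (H : Defs.rgraph k.+4 (vertex gT k a b c)) :
  large_girth gen n -> (1 < n)%N -> rgraph_order H = n ->
  subgraph H (config_rgraph gen k a b c) ->
  density R H <= 2 * (n%:R / k.+4%:R) ^+ k.+4 / 'C(n, k.+4)%:R.
Proof.
move=> gir n1 Hn /andP[_ /subsetP sub].
rewrite /density card_rsubsets -/(rgraph_order H) Hn ler_wpM2r ?invr_ge0 //.
rewrite -Hn in gir n1 *; apply: le_trans (configs_in_le R gir n1).
rewrite ler_nat; apply: leq_trans (leq_imset_card (@edge_of gT k a b c) _).
apply: subset_leq_card; apply/subsetP => e eH.
have /imsetP[t tC et] := sub _ eH; rewrite et; apply: imset_f.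
rewrite inE tC -et; move/subsetP/(_ _ eH): (edges_sub H).
by rewrite inE => /andP[].
Qed.

(** * Choice of the parameters and the contradiction *)

Theorem theorem1p2 (R : realType) (r : nat) (hr : (4 <= r)%N) :
  non_jump r (2 * (r`!%:R / r%:R ^+ r) : R).
Proof.
case: r hr => [|[|[|[|k]]]] // _; set r := k.+4; set alpha := 2 * _.
have rr0 : 0 < r%:R ^+ r :> R by rewrite exprn_gt0.
have alpha0 : 0 < alpha by rewrite mulr_gt0 ?divr_gt0 // ltr0n fact_gt0.
have alpha1 : alpha < 1.
  by rewrite /alpha mulrA ltr_pdivrMr // mul1r -natrX -natrM ltr_nat two_fact_lt_expn.
have alpha01 : 0 <= alpha < 1 by rewrite ltW.
split=> // -[_ [delta delta0 jmp]].
(* The first summand makes [large_n] hold, the second gives [r <= n]. *)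
pose n := (Num.bound (r%:R ^+ 2 * (alpha + delta) / delta) + r)%N.
have rn : (r <= n)%N by rewrite leq_addl.
have n1 : (1 < n)%N by apply: leq_trans rn.
have large_n : r%:R ^+ 2 * (alpha + delta) < n%:R * delta.
  rewrite -ltr_pdivrMr // /n natrD ltr_wpDr //.
  by rewrite archi_boundP // divr_ge0 ?mulr_ge0 ?addr_ge0 ?exprn_ge0 // ltW.
have [gT [gen gir]] := @exists_large_girth label n.
have t0 : (0 < #|gT|)%N by apply/card_gt0P; exists 1%g.
(* Here [eps] is the excess density of the construction. It may depend on [n] through [gT], because
   [delta] is fixed before both. *)
have [|N] := jmp (alpha / (3 * #|gT|%:R)) n _ rn.
  by rewrite divr_gt0 // mulr_gt0 // ltr0n.
move=> /(_ _ (config_rgraph gen k (6 * N.+1) (#|gT| * N.+1) (3 * (#|gT| * N.+1)))).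
case=> [||H [sub Hn]].
- rewrite /rgraph_order /= cardsT card_vertex.
  apply: leq_trans (leqnSn N) _; rewrite mulnA mulnA leq_pmull //.
  by rewrite !muln_gt0.
- apply: le_trans (density_config_rgraph R k gir n1 (ltn0Sn N)).
  by rewrite mulrDr mulr1.
move=> /le_trans /(_ (density_subgraph_le R gir n1 Hn sub)).
have bin0 : 0 < 'C(n, r)%:R :> R by rewrite ltr0n bin_gt0.
have f0 : 0 < r`!%:R :> R by rewrite ltr0n fact_gt0.
rewrite ler_pdivlMr // -(ler_pM2r f0) -mulrA natr_bin_fact expr_div_n.
have -> : 2 * (n%:R ^+ r / r%:R ^+ r) * r`!%:R = alpha * n%:R ^+ r :> R.
  by rewrite /alpha; field; rewrite lt0r_neq0.
have n0 : 0 < n%:R :> R by rewrite ltr0n ltnW.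
have := ffactn_ge R rn; rewrite -(ler_pM2l n0).
have := exprn_gt0 r n0; rewrite exprS.
set z := n%:R ^+ r => z0 fge dle.
have ad0 : 0 <= alpha + delta by rewrite addr_ge0 ?ltW.
(* Now [dle] says [(alpha + delta) n^_r <= alpha n^r], up to a factor [n]. With [fge] this gives
   [n delta <= r^2 (alpha + delta)], against the choice of [n]. *)
have := ler_wpM2l ad0 fge.
have : z * (r%:R ^+ 2 * (alpha + delta)) < z * (n%:R * delta) by rewrite ltr_pM2l.
lra.
Qed.
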